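(* Let $\mathcal{G}\subset U(2)$ be a fixed finite universal set of single-qubit quantum gates, and assume the optimality of the Solovay-Kitaev algorithm for $\mathcal{G}$, i.e. there is no function $L(\epsilon)=o\!\left(\log\frac1\epsilon\right)$ (as $\epsilon\to0^+$) such that for all sufficiently small $\epsilon>0$ every $U\in U(2)$ can be approximated to accuracy $\epsilon$ by a gate array over $\mathcal{G}$ of length at most $L(\epsilon)$. For each positive integer $p$ let $\theta_p=\frac{\pi}{2p}$ and $$R(\theta_p)=\begin{pmatrix}\cos\theta_p & \sin\theta_p\\ -\sin\theta_p & \cos\theta_p\end{pmatrix}.$$ Then no algorithm can approximate all $R(\theta_p)$, for $p$ sufficiently large, to any accuracy $\epsilon_p$ with $o\!\left(\log\frac{1}{\epsilon_p}\right)$ gates. That is, there are no function $\ell(\epsilon)=o\!\left(\log\frac1\epsilon\right)$ (as $\epsilon\to0^+$), integer $P$ and $\epsilon_*>0$ such that for every integer $p\ge P$ and every accuracy $0<\epsilon_p\le\epsilon_*$ there is a gate array over $\mathcal{G}$ of length at most $\ell(\epsilon_p)$ that approximates $R(\theta_p)$ to accuracy $\epsilon_p$.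
   Context: A finite set $\mathcal{G}\subset U(2)$ is universal if every unitary operator in $U(2)$ can be approximated to arbitrary accuracy by finite products of elements of $\mathcal{G}$. A gate array of length $L$ over $\mathcal{G}$ is a product $U_1U_2\cdots U_L$ with each $U_i\in\mathcal{G}$. A gate array with product $V$ approximates a unitary $U$ to accuracy $\eta$ if $\|U-V\|_2\le\eta$, where $\|\cdot\|_2$ is the operator (spectral) norm. *)

(* Defs.v *)
From HB Require Import structures.
From mathcomp Require Import all_boot all_order all_algebra.
From mathcomp Require Import complex.
From mathcomp Require Import all_classical all_reals all_analysis.

Set Implicit Arguments.
Unset Strict Implicit.
Unset Printing Implicit Defensive.

Import Order.TTheory GRing.Theory Num.Theory.
Import numFieldNormedType.Exports.

Local Open Scope classical_set_scope.
Local Open Scope ring_scope.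
Local Open Scope complex_scope.

Definition l2norm (R : realType) (n : nat) (v : 'cV[R[i]]_n) : R :=
  Num.sqrt (\sum_(i < n) ComplexField.Normc.normc (v i 0) ^+ 2).

(* The library norm on matrices is the entrywise maximum, hence this definition
   of the operator norm induced by the Euclidean norm on column vectors. *)
Definition opnorm (R : realType) (n : nat) (A : 'M[R[i]]_n) : R :=
  sup [set l2norm (A *m v) | v in [set v : 'cV[R[i]]_n | l2norm v = 1]].

Definition U2 (R : realType) : set 'M[R[i]]_2 :=
  [set A | A \is unitarymx].
Arguments U2 R : clear implicits.

(* The word w = [:: U_1; ...; U_L] stands for the gate array U_1 U_2 ... U_L of
   length L; the empty word is the empty product, i.e. the identity. *)
Definition gate_array (R : realType) (G : set 'M[R[i]]_2)
    (w : seq 'M[R[i]]_2) : Prop :=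
  forall A, A \in w -> G A.

Definition array_prod (R : realType) (w : seq 'M[R[i]]_2) : 'M[R[i]]_2 :=
  \prod_(A <- w) A.

Definition approximates (R : realType) (w : seq 'M[R[i]]_2)
    (U : 'M[R[i]]_2) (eta : R) : Prop :=
  opnorm (U - array_prod w) <= eta.

Definition universal (R : realType) (G : set 'M[R[i]]_2) : Prop :=
  forall U, U2 R U -> forall eta : R, 0 < eta ->
    exists w, gate_array G w /\ approximates w U eta.

Definition approximable_within (R : realType) (G : set 'M[R[i]]_2)
    (U : 'M[R[i]]_2) (eta bound : R) : Prop :=
  exists w, [/\ gate_array G w, (size w)%:R <= bound & approximates w U eta].

Definition sublog (R : realType) (l : R -> R) : Prop :=
  l =o_ (0^'+) (fun eps : R => ln (eps^-1)).

Definition SK_optimal (R : realType) (G : set 'M[R[i]]_2) : Prop :=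
  ~ exists L : R -> R, sublog L /\
      (\forall eps \near 0^'+, forall U, U2 R U ->
        approximable_within G U eps (L eps)).

Definition theta (R : realType) (p : nat) : R := pi / (2 * p%:R).

Definition rotation (R : realType) (t : R) : 'M[R[i]]_2 :=
  \matrix_(i, j)
    (if i == 0 then (if j == 0 then cos t else sin t)
     else (if j == 0 then - sin t else cos t))%:C.

(* Main.v *)
(* A counting argument. The sines of theta_N, ..., theta_(2N-1) differ pairwise
   by at least c / N^2, and an entry of a matrix is bounded by its operator norm,
   so for N large gate arrays approximating these N rotations to accuracy
   N^-3 must be pairwise distinct. There are at most K^n words of length at most
   n over a finite gate set, so n >= ln N / ln K, which is of the order of
   ln (1 / N^-3) and hence exceeds any sublogarithmic bound. *)
Require Import Defs.
From HB Require Import structures.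
From mathcomp Require Import all_boot all_order all_algebra.
From mathcomp Require Import complex.
From mathcomp Require Import ring lra.
From mathcomp Require Import all_classical all_reals all_analysis.

Set Implicit Arguments.
Unset Strict Implicit.
Unset Printing Implicit Defensive.

Import Order.TTheory GRing.Theory Num.Theory.
Import numFieldNormedType.Exports.

Local Open Scope classical_set_scope.
Local Open Scope ring_scope.
Local Open Scope complex_scope.

(** Padding each word with [None] to length exactly [n] maps the words into [n]-tuples over the
    letters and one blank. Dropping the blanks recovers the word, so distinct words have distinct
    paddings. *)
Lemma leq_card_words (T : choiceType) (s : seq T) (N n : nat)
    (w : 'I_N -> seq T) :
  (forall i, {subset w i <= s}) -> (forall i, size (w i) <= n)%N ->
  injective w -> (N <= #|{: option (seq_sub s)}| ^ n)%N.
Proof.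
move=> ws wn winj.
pose pad i : seq (option (seq_sub s)) :=
  map insub (w i) ++ nseq (n - size (w i)) None.
have padn i : size (pad i) == n.
  by rewrite size_cat size_map size_nseq subnKC.
have padK i : [seq val x | x <- pmap id (pad i)] = w i.
  rewrite /pad pmap_cat map_cat.
  have -> k : pmap id (nseq k (@None (seq_sub s))) = [::] by elim: k.
  rewrite cats0; elim: (w i) (ws i) => //= x v IHv vs.
  rewrite insubT /= ?vs ?mem_head// => xs; congr cons.
  by apply: IHv => y yv; apply: vs; rewrite inE yv orbT.
rewrite -card_tuple -[X in (X <= _)%N]card_ord.
apply: (leq_card (fun i => Tuple (padn i))) => i j /(congr1 val) /= ij.
by apply: winj; rewrite -padK ij padK.
Qed.

Local Notation normc := ComplexField.Normc.normc.

Lemma normc_ge0 (R : realType) (x : R[i]) : 0 <= normc x.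
Proof. by case: x => a b; rewrite sqrtr_ge0. Qed.

Lemma normc_le_l2norm (R : realType) (n : nat) (v : 'cV[R[i]]_n) i :
  normc (v i 0) <= l2norm v.
Proof.
rewrite -[leLHS]ger0_norm ?normc_ge0// -sqrtr_sqr ler_wsqrtr//.
by rewrite (bigD1 i)//= lerDl sumr_ge0// => j _; exact: sqr_ge0.
Qed.

(** Without an upper bound the [sup] in [opnorm] would be a mere default value. The entries of a
    unit vector have modulus at most 1, so the absolute row sums of [A] give a bound. *)
Lemma opnorm_has_ubound (R : realType) (n : nat) (A : 'M[R[i]]_n) :
  has_ubound [set l2norm (A *m v) | v in [set v : 'cV[R[i]]_n | l2norm v = 1]].
Proof.
exists (Num.sqrt (\sum_(i < n) (\sum_(j < n) normc (A i j)) ^+ 2)).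
move=> _ [v /= v1 <-]; apply: ler_wsqrtr; apply: ler_sum => i _.
rewrite ler_sqr ?nnegrE ?normc_ge0 ?sumr_ge0// => [|j _]; last exact: normc_ge0.
rewrite mxE.
apply: (@le_trans _ _ (\sum_(j < n) normc (A i j * v j 0))).
  elim/big_ind2 : _ => [|x a y b xa yb|//].
    by rewrite ComplexField.Normc.normc0.
  by apply: (le_trans (le_normcD _ _)); apply: lerD.
apply: ler_sum => j _; rewrite ComplexField.Normc.normcM.
by rewrite ler_piMr ?normc_ge0// -v1 normc_le_l2norm.
Qed.

(** Test the operator norm on the basis vector [e], whose image is column [j]. *)
Lemma normc_le_opnorm (R : realType) (n : nat) (A : 'M[R[i]]_n) i j :
  normc (A i j) <= opnorm A.
Proof.
pose e : 'cV[R[i]]_n := delta_mx j 0.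
have Ae : A *m e = col j A by rewrite colE.
have e1 : l2norm e = 1.
  rewrite /l2norm (bigD1 j)//= big1 ?addr0 => [|k kj].
    by rewrite mxE !eqxx ComplexField.Normc.normc1 expr1n sqrtr1.
  by rewrite mxE (negbTE kj) ComplexField.Normc.normc0 expr0n.
apply: (@le_trans _ _ (l2norm (A *m e))).
  by rewrite Ae (le_trans _ (normc_le_l2norm _ i))// mxE.
by apply: ub_le_sup; [exact: opnorm_has_ubound|exists e].
Qed.

Lemma approximates_sin (R : realType) (w : seq 'M[R[i]]_2) (t eta : R) :
  approximates w (rotation t) eta ->
  `|sin t - complex.Re (array_prod w 0 1)| <= eta.
Proof.
apply: le_trans; apply: le_trans (normc_le_opnorm _ 0 1).
rewrite !mxE /=; case: (array_prod w 0 1) => a b /=.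
by rewrite -sqrtr_sqr ler_wsqrtr// lerDl sqr_ge0.
Qed.

Lemma theta_itv (R : realType) (p : nat) : (1 < p)%N -> 0 < theta R p < 1.
Proof.
move=> p1; have p0 : 0 < p%:R :> R by rewrite ltr0n ltnW.
rewrite /theta divr_gt0 ?pi_gt0 ?mulr_gt0//= ltr_pdivrMr ?mulr_gt0// mul1r.
have := @pihalf_lt2 R; have : 2 <= p%:R :> R by rewrite ler_nat.
lra.
Qed.

(** Mean value theorem: the angles differ by [pi / 2 * (q - p) / (p * q)], where [p * q] is at most
    [(2 * N) ^ 2]. Both lie in (0, 1), where the derivative [cos] is at least [cos 1]. *)
Lemma sin_theta_gap (R : realType) (N p q : nat) :
  (1 < N <= p)%N -> (p < q < N.*2)%N ->
  cos 1 / (4 * N%:R ^+ 2) <= sin (theta R p) - sin (theta R q).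
Proof.
move=> /andP[N1 Np] /andP[pq qN].
have p1 : (1 < p)%N by exact: leq_trans Np.
have q1 : (1 < q)%N by exact: ltn_trans pq.
have [/andP[tp0 tp1] /andP[tq0 tq1]] := (theta_itv R p1, theta_itv R q1).
have p0 : 0 < p%:R :> R by rewrite ltr0n ltnW.
have q0 : 0 < q%:R :> R by rewrite ltr0n ltnW.
have N0 : 0 < N%:R :> R by rewrite ltr0n ltnW.
have pqR : p%:R + 1 <= q%:R :> R by rewrite natr1 ler_nat.
have qNR : q%:R <= 2 * N%:R :> R by rewrite -natrM ler_nat mul2n ltnW.
have gap : (4 * N%:R ^+ 2)^-1 <= theta R p - theta R q.
  have -> : theta R p - theta R q = pi / 2 * ((q%:R - p%:R) / (p%:R * q%:R)).
    by rewrite /theta; field; rewrite !gt_eqF.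
  apply: (@le_trans _ _ ((p%:R * q%:R)^-1)).
    rewrite lef_pV2 ?posrE ?mulr_gt0 ?exprn_gt0//.
    have -> : 4 * N%:R ^+ 2 = (2 * N%:R) * (2 * N%:R) :> R by ring.
    by apply: ler_pM; lra.
  rewrite mulrA ler_peMl ?invr_ge0 ?mulr_ge0//.
  by rewrite mulr_ege1 ?pihalf_ge1// lerBrDl.
have tqp : theta R q < theta R p.
  by rewrite -subr_gt0 (lt_le_trans _ gap)// invr_gt0 mulr_gt0 ?exprn_gt0.
have [|c] := @MVT R sin cos _ _ tqp.
  by apply: continuous_subspaceT => x; exact: continuous_sin.
rewrite in_itv/= => /andP[qc cp] ->.
have c1 : cos 1 <= cos c.
  apply/ltW; rewrite ltr_cos ?in_itv/=; have := @pi_ge2 R; lra.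
by apply: ler_pM => //; rewrite ?invr_ge0 ?mulr_ge0 ?exprn_ge0 ?ltW// cos1_gt0.
Qed.

Theorem theorem4 (R : realType) (G : set 'M[R[i]]_2)
    (finG : finite_set G) (GU2 : G `<=` U2 R)
    (univG : universal G) (optG : SK_optimal G) :
  ~ exists (l : R -> R) (P : nat) (eps0 : R),
      [/\ sublog l, 0 < eps0 &
          forall p : nat, (0 < p)%N -> (P <= p)%N ->
          forall eps : R, 0 < eps -> eps <= eps0 ->
            approximable_within G (rotation (theta R p)) eps (l eps)].
Proof.
move=> [l [P [eps0 [lo e0 lP]]]].
have /finite_seqP[s Gs] := finG.
set K := #|{: option (seq_sub s)}|.
have K1 : (0 < K)%N by apply/card_gt0P; exists None.
(* With [ln eps^-1 = 3 * ln N] this constant yields [K * l eps <= 3 / 4 * ln N], and the factor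
   below 1 gives the final contradiction. *)
have /eqoP/(_ (4 * K%:R)^-1) := lo.
rewrite invr_gt0 mulr_gt0 ?ltr0n// => /(_ isT) [d /= d0 dl].
have c0 : 0 < cos 1 :> R := cos1_gt0 R.
(* The bounds with [d] and [eps0] place [N^-1], hence [eps], in the range of both hypotheses; the
   one with [cos 1] makes [2 * eps] smaller than the sine gap. *)
have [N] : exists N, [/\ (1 < N)%N, (P <= N)%N, d^-1 < N%:R, eps0^-1 <= N%:R &
    8 / cos 1 < N%:R :> R].
  pose B : R := d^-1 + eps0^-1 + 8 / cos 1.
  exists (maxn (maxn 2 P) (Num.truncn B).+1).
  have BN : B < (maxn (maxn 2 P) (Num.truncn B).+1)%:R.
    by rewrite (lt_le_trans (truncnS_gt _))// ler_nat leq_maxr.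
  have [d1 e1 c1] : [/\ 0 < d^-1, 0 < eps0^-1 & 0 < 8 / cos 1 :> R].
    by split; rewrite ?invr_gt0 ?divr_gt0.
  split; rewrite ?leq_max ?leqnn ?orbT//; move: BN; rewrite /B; lra.
move=> [N1 PN dN eN cN].
have N0 : 0 < N%:R :> R by rewrite ltr0n ltnW.
have N1R : 1 < N%:R :> R by rewrite ltr1n.
(* Any power beyond 2 makes [eps] smaller than the [1 / N^2] gap for large N. *)
pose eps : R := N%:R ^- 3.
have eps_gt0 : 0 < eps by rewrite invr_gt0 exprn_gt0.
have epsN : eps <= N%:R^-1.
  by rewrite lef_pV2 ?posrE ?exprn_gt0// ler_eXnr// ltW.
have ln0 : 0 < ln (N%:R : R) by rewrite ln_gt0.
have leps : l eps <= 3 / (4 * K%:R) * ln N%:R.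
  have eps_d : eps < d by rewrite (le_lt_trans epsN)// invf_plt ?posrE.
  have : `|l eps| <= (4 * K%:R)^-1 * `|ln eps^-1|.
    by apply: dl => //=; rewrite sub0r normrN gtr0_norm.
  move=> /(le_trans (ler_norm _)) /le_trans; apply.
  rewrite invrK lnXn// gtr0_norm ?pmulrn_lgt0// -[_ *+ 3]mulr_natl.
  by rewrite mulrA (mulrC _^-1).
have eps_eps0 : eps <= eps0.
  by rewrite (le_trans epsN)// invf_ple ?posrE.
have happ (i : 'I_N) :
    approximable_within G (rotation (theta R (N + i))) eps (l eps).
  by apply: lP => //; rewrite ?addn_gt0 ?(ltnW N1)// (leq_trans PN)// leq_addr.
have [w wP] := choice happ.
have w_neq (i j : 'I_N) : (i < j)%N -> w i <> w j.
  move=> ij wij; have [[_ _ wi] [_ _ wj]] := (wP i, wP j).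
  have gap : cos 1 / (4 * N%:R ^+ 2) <=
      sin (theta R (N + i)) - sin (theta R (N + j)).
    apply: (@sin_theta_gap R N); rewrite ?N1 ?leq_addr//.
    by rewrite ltn_add2l ij/= -addnn ltn_add2l.
  (* A common word would put both sines within [eps] of the same matrix entry. *)
  have : cos 1 / (4 * N%:R ^+ 2) <= 2 * eps.
    move: (approximates_sin wi) (approximates_sin wj).
    rewrite wij !ler_norml => /andP[? ?] /andP[? ?]; lra.
  rewrite ler_pdivrMr ?mulr_gt0 ?exprn_gt0// leNgt => /negP; apply.
  have -> : 2 * eps * (4 * N%:R ^+ 2) = 8 / N%:R.
    by rewrite /eps; field; rewrite gt_eqF.
  by rewrite ltr_pdivrMr// mulrC -ltr_pdivrMr.
have winj : injective w.
  move=> i j wij; apply/val_inj; apply/eqP.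
  by case: ltngtP => // /w_neq; rewrite wij.
(* [Num.truncn] rounds down only on nonnegative arguments; the sign comes from the length of any of
   the words. *)
have l_ge0 : 0 <= l eps.
  have [_ + _] := wP (Ordinal (ltnW N1)); exact: le_trans.
have NK : (N <= K ^ Num.truncn (l eps))%N.
  apply: (leq_card_words (w := w)) => // i.
    by have [Gw _ _] := wP i; move=> A /Gw; rewrite Gs.
  by have [_ sw _] := wP i; rewrite truncn_ge_nat.
have lnN : ln N%:R <= ln (K%:R : R) *+ Num.truncn (l eps).
  rewrite -lnXn ?ltr0n// ler_ln ?posrE ?exprn_gt0 ?ltr0n ?(ltnW N1)//.
  by rewrite -natrX ler_nat.
(* This crude bound avoids dividing by [ln K], which vanishes when [K = 1]. *)
have lnK : ln (K%:R : R) <= K%:R.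
  have K0 : 0 < K%:R :> R by rewrite ltr0n.
  have := @le_ln1Dx R (K%:R - 1); rewrite (addrC 1) subrK => lnK1.
  by rewrite (le_trans (lnK1 _))//; lra.
have : ln (N%:R : R) <= 3 / 4 * ln N%:R.
  apply: (le_trans lnN); rewrite -[leLHS]mulr_natr.
  apply: (@le_trans _ _ (K%:R * l eps)).
    by apply: ler_pM; rewrite ?ln_ge0 ?ler1n ?truncn_le.
  apply: (le_trans (ler_wpM2l (ler0n _ _) leps)).
  suff -> : K%:R * (3 / (4 * K%:R) * ln N%:R) = 3 / 4 * ln N%:R :> R by [].
  by field; rewrite pnatr_eq0 -lt0n.
lra.
Qed.
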